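(* Let $A$ and $B$ be positive integers with $B \ge 4$ and $\sqrt{p_A} > B$, and suppose that for every integer $n > A$ the consecutive primes $p_{n-1}, p_n$ satisfy $\sqrt{p_n} - \sqrt{p_{n-1}} < B/2$. Then for every real number $x > p_A$ there is a prime number $p$ with $(x-1)^3 < p < x^3$.
   Context: $p_1 = 2 < p_2 = 3 < p_3 < \cdots$ denotes the increasing enumeration of all prime numbers, so $p_n$ is the $n$-th prime. *)

(* Defs.v *)
From mathcomp Require Import all_boot.

Set Implicit Arguments.
Unset Strict Implicit.
Unset Printing Implicit Defensive.

Lemma exists_prime_gt (m : nat) : exists p, prime p && (m < p).
Proof. by case: (prime_above m) => p lt_mp pr_p; exists p; rewrite pr_p. Qed.

Definition next_prime (m : nat) : nat := ex_minn (exists_prime_gt m).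

(* Numbered from 1: nth_prime 1 = 2, nth_prime 2 = 3, ...; the value
   nth_prime 0 = 0 is junk. *)
Definition nth_prime (n : nat) : nat := iter n next_prime 0.

Lemma nth_prime_prime n : 0 < n -> prime (nth_prime n).
Proof.
case: n => // n _; rewrite /nth_prime iterS /next_prime.
by case: ex_minnP => p /andP[].
Qed.

Lemma nth_prime_ltS n : nth_prime n < nth_prime n.+1.
Proof.
rewrite {2}/nth_prime iterS -/(nth_prime n) /next_prime.
by case: ex_minnP => p /andP[].
Qed.

Lemma nth_prime_surj p : prime p -> exists2 n, 0 < n & nth_prime n = p.
Proof.
move=> pr_p.
have ge_n n : n <= nth_prime n.
  by elim: n => // n IHn; apply: leq_ltn_trans IHn (nth_prime_ltS n).
have exn : exists n, p <= nth_prime n by exists p.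
case: (ex_minnP exn) => -[|n] le_p min_n.
  by move: le_p (prime_gt0 pr_p); case: p {pr_p exn min_n}.
exists n.+1 => //; apply/eqP; rewrite eqn_leq le_p andbT.
have lt_p : nth_prime n < p.
  by rewrite ltnNge; apply/negP => /min_n; rewrite ltnn.
rewrite /nth_prime iterS -/(nth_prime n) /next_prime.
by case: ex_minnP => q _; apply; rewrite pr_p.
Qed.

(* Main.v *)
(** Let [p_n] be the first prime that is at least [x ^ 3]; then [n > A] and
    [p_(n-1) < x ^ 3].  If [p_(n-1) <= (x - 1) ^ 3], then with [s = sqrt x]
    we would have [sqrt p_(n-1) <= s ^ 3 - s / 2] and [sqrt p_n >= s ^ 3], so
    the gap of square roots would be at least [s / 2 > B / 2]. *)
Require Import Defs.
From mathcomp Require Import all_boot all_order all_algebra.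
From mathcomp Require Import reals.
From mathcomp Require Import ring lra.

Import Order.TTheory GRing.Theory Num.Theory.

Local Open Scope ring_scope.

Lemma leq_nth_prime n : (n <= nth_prime n)%N.
Proof. by elim: n => // n IHn; apply: leq_ltn_trans IHn (nth_prime_ltS n). Qed.

Lemma nth_prime_homo : {homo nth_prime : m n / (m <= n)%N}.
Proof.
apply: (homo_leq leqnn leq_trans) => n.
exact: ltnW (nth_prime_ltS n).
Qed.

(** Since [n <= nth_prime n], some term reaches [y]. Monotonicity puts the least such index beyond
    [A], so its predecessor is the witness. *)
Lemma nth_prime_bracket (R : archiRealFieldType) (A : nat) (y : R) :
  (nth_prime A)%:R < y ->
  exists2 n, (A <= n)%N & (nth_prime n)%:R < y <= (nth_prime n.+1)%:R.
Proof.
move=> A_lt_y.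
have [n0 y_le] : exists n, y <= (nth_prime n)%:R.
  exists (Num.bound `|y|); apply: le_trans (ler_norm y) _.
  apply: le_trans (ltW (archi_boundP (normr_ge0 y))) _.
  by rewrite ler_nat leq_nth_prime.
case: (ex_minnP (ex_intro (fun n => y <= (nth_prime n)%:R) n0 y_le)).
move=> n {}y_le n_min.
have A_lt_n : (A < n)%N.
  rewrite ltnNge; apply/negP => /nth_prime_homo; rewrite -(ler_nat R) => nA.
  by have := lt_le_trans A_lt_y (le_trans y_le nA); rewrite ltxx.
case: n => // n in y_le n_min A_lt_n *.
exists n => //; rewrite y_le andbT ltNge; apply/negP => /n_min.
by rewrite ltnn.
Qed.

Lemma sqrt_cube_gap (R : rcfType) (x a b : R) :
  1 <= x -> a <= (x - 1) ^+ 3 -> x ^+ 3 <= b ->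
  Num.sqrt x / 2 <= Num.sqrt b - Num.sqrt a.
Proof.
move=> x_ge1 a_le b_ge.
have x_ge0 : 0 <= x by lra.
set s := Num.sqrt x.
have s_ge1 : 1 <= s by rewrite -[1]sqrtr1 ler_sqrt.
have sE : x = s ^+ 2 by rewrite sqr_sqrtr.
have sqrt_b : s ^+ 3 <= Num.sqrt b.
  have -> : s ^+ 3 = Num.sqrt (x ^+ 3).
    by rewrite sE exprAC sqrtr_sqr ger0_norm ?exprn_ge0 //; lra.
  exact: ler_wsqrtr.
have sqrt_a : Num.sqrt a <= s ^+ 3 - s / 2.
  have h_ge0 : 0 <= s ^+ 3 - s / 2 by nra.
  (* Writing the bound as the root of its square leaves a polynomial inequality; a negative [a] is
     covered, its root being 0 by convention. *)
  rewrite -[leRHS]ger0_norm // -sqrtr_sqr; apply: ler_wsqrtr.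
  apply: le_trans a_le _; rewrite sE -subr_ge0.
  (* Expanded in powers of [s ^+ 2 - 1 >= 0], the difference has only positive coefficients. *)
  have -> : (s ^+ 3 - s / 2) ^+ 2 - (s ^+ 2 - 1) ^+ 3
      = 2 * (s ^+ 2 - 1) ^+ 2 + 5 / 4 * (s ^+ 2 - 1) + 1 / 4 by field.
  have : 1 <= s ^+ 2 by rewrite -sE.
  by have := sqr_ge0 (s ^+ 2 - 1); lra.
lra.
Qed.

Theorem theorem8 (R : realType) (A B : nat)
  (A_gt0 : (0 < A)%N) (B_gt0 : (0 < B)%N) (B_ge4 : (4 <= B)%N)
  (sqrt_pA : B%:R < Num.sqrt ((nth_prime A)%:R : R))
  (sqrt_gap : forall n : nat, (A < n)%N ->
     Num.sqrt ((nth_prime n)%:R : R) - Num.sqrt ((nth_prime n.-1)%:R : R)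
       < B%:R / 2%:R)
  (x : R) (x_gt : (nth_prime A)%:R < x) :
  exists p : nat, prime p /\ (x - 1) ^+ 3 < p%:R /\ p%:R < x ^+ 3.
Proof.
have x_gt1 : 1 < x.
  by apply: le_lt_trans x_gt; rewrite ler1n prime_gt0 ?nth_prime_prime.
have x_le_cube : x <= x ^+ 3 by rewrite ler_eXnr // ltW.
(* The index is shifted: [n] here is the n - 1 of the overview, so [n >= A]. *)
have [n A_le_n /andP[pn_lt pn1_ge]] :=
  nth_prime_bracket _ _ _ (lt_le_trans x_gt x_le_cube).
(* [0 < A <= n] rules out the junk value [nth_prime 0]. *)
exists (nth_prime n); split; first exact/nth_prime_prime/(leq_trans A_gt0).
split=> //; rewrite ltNge; apply/negP => pn_le.
have B_lt_sqrt : B%:R < Num.sqrt x.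
  exact: lt_le_trans sqrt_pA (ler_wsqrtr (ltW x_gt)).
have := sqrt_gap n.+1 A_le_n.
have := sqrt_cube_gap _ _ _ _ (ltW x_gt1) pn_le pn1_ge.
by rewrite /=; lra.
Qed.
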